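(* For $n\ge 0$, $$P_{n+1}(x,y,z,w)=wP_n(x,y,z,w)+\sum_{k=0}^{n-1}\binom{n}{k}P_k(x,y,z,w)\,Q_{n-k}(x,y,z,w).$$
   Context: For a permutation $\pi=\pi_1\cdots\pi_n$ of $[n]=\{1,\dots,n\}$: an index $i$ is an exterior peak if either $i=1$ and $\pi_1>\pi_2$, or $1<i<n$ and $\pi_{i-1}<\pi_i>\pi_{i+1}$; an index $i$ is a proper double descent if $3\le i\le n$ and $\pi_{i-2}>\pi_{i-1}>\pi_i$. Let $P_n(i,j)$ be the number of permutations of $[n]$ with $i$ exterior peaks and $j$ proper double descents, and $P_n(x,y,z,w)=\sum_{i,j}P_n(i,j)x^iy^jz^{i+1}w^{n-2i-j}$ (so $P_0=z$, from the empty permutation). Further, setting $\pi_0=\pi_{n+1}=0$, for $1\le i\le n$ an index $i$ is a peak if $\pi_{i-1}<\pi_i>\pi_{i+1}$ and a double descent if $\pi_{i-1}>\pi_i>\pi_{i+1}$; let $Q_n(i,j)$ be the number of permutations of $[n]$ with $i$ peaks and $j$ double descents, and for $n\ge1$ let $Q_n(x,y,z,w)=\sum_{i,j}Q_n(i,j)x^iy^jz^iw^{n+1-2i-j}$. *)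

(* Defs.v *)
From HB Require Import structures.
From mathcomp Require Import all_boot all_order all_algebra all_fingroup.
Set Implicit Arguments.
Unset Strict Implicit.
Unset Printing Implicit Defensive.
Import GRing.Theory.
Local Open Scope ring_scope.

(* [letter s i] is the value pi_i in one-line notation, with positions and
   values both 1-based (s : 'S_n acts on 0, ..., n-1); it is 0 when i = 0 or
   i > n, which gives the convention pi_0 = pi_(n+1) = 0. *)
Definition letter (n : nat) (s : 'S_n) (i : nat) : nat :=
  if i is k.+1 then
    if insub k is Some k' then (s k').+1 else 0%N
  else 0%N.

(* pi_1 > pi_2 presupposes that pi_2 exists, hence the test 1 < n: the value
   0 of [letter] outside 1, ..., n must not be used here. *)
Definition exterior_peak (n : nat) (s : 'S_n) (i : nat) : bool :=
  [|| [&& i == 1%N, (1 < n)%N & (letter s 2 < letter s 1)%N]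
    | [&& (1 < i < n)%N, (letter s i.-1 < letter s i)%N
        & (letter s i.+1 < letter s i)%N]].

Definition proper_double_descent (n : nat) (s : 'S_n) (i : nat) : bool :=
  [&& (3 <= i <= n)%N, (letter s i.-1 < letter s i.-2)%N
    & (letter s i < letter s i.-1)%N].

Definition peak (n : nat) (s : 'S_n) (i : nat) : bool :=
  [&& (1 <= i <= n)%N, (letter s i.-1 < letter s i)%N
    & (letter s i.+1 < letter s i)%N].

Definition double_descent (n : nat) (s : 'S_n) (i : nat) : bool :=
  [&& (1 <= i <= n)%N, (letter s i < letter s i.-1)%N
    & (letter s i.+1 < letter s i)%N].

(* The number of indices in 1, ..., n satisfying a. *)
Definition index_count (n : nat) (a : pred nat) : nat := count a (iota 1 n).

Definition P_num (n i j : nat) : nat :=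
  #|[set s : 'S_n | (index_count n (exterior_peak s) == i)
                 && (index_count n (proper_double_descent s) == j)]|.

Definition Q_num (n i j : nat) : nat :=
  #|[set s : 'S_n | (index_count n (peak s) == i)
                 && (index_count n (double_descent s) == j)]|.

(* The indeterminates x, y, z, w are arbitrary elements of a commutative ring;
   taking R = Z[x,y,z,w] recovers the polynomials themselves.  The truncated
   subtractions in the exponents of w are harmless: P_num n i j != 0 implies
   2 i + j <= n, and Q_num n i j != 0 with n > 0 implies 2 i + j <= n + 1
   (the difference is then the number of double ascents). *)
Definition P_poly (R : comNzRingType) (n : nat) (x y z w : R) : R :=
  \sum_(i < n.+1) \sum_(j < n.+1)
    (P_num n i j)%:R * x ^+ i * y ^+ j * z ^+ i.+1 * w ^+ (n - 2 * i - j).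

(* Only meaningful for n > 0. *)
Definition Q_poly (R : comNzRingType) (n : nat) (x y z w : R) : R :=
  \sum_(i < n.+1) \sum_(j < n.+1)
    (Q_num n i j)%:R * x ^+ i * y ^+ j * z ^+ i * w ^+ (n.+1 - 2 * i - j).

(* Main.v *)
(* Bound each permutation by pi_0 = 0 on the left and by pi_(n+1) = +oo (for
   P) or 0 (for Q) on the right, and give every letter the weight x, y, z or w
   according to whether it is a peak, a double descent, a valley or a double
   ascent.  Peaks and valleys alternate, so P_n and Q_n are z times the sum of
   the weights of all permutations.  Removing the smallest letter m from a
   permutation u m v leaves u bounded on the right by a smaller value, hence
   counted by Q, and v bounded on the left by a smaller value and on the right
   by +oo, hence counted by P; m itself is a valley, or a double ascent when u
   is empty. *)
Require Import Defs.
From HB Require Import structures.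
From mathcomp Require Import all_boot all_order all_algebra all_fingroup.
From mathcomp Require Import zify ring.
Set Implicit Arguments.
Unset Strict Implicit.
Unset Printing Implicit Defensive.
Import GRing.Theory.
Local Open Scope ring_scope.

(** * Weights of words and removal of the smallest letter *)

(* [rises e t i] tells whether the step from the letter at position i - 1
   (0-based) to the one at position i goes up, where the left boundary is 0 and
   the right boundary is +oo if [e] and 0 otherwise. *)
Definition rises (e : bool) (t : seq nat) (i : nat) : bool :=
  (i == 0%N) || (if (i < size t)%N then (nth 0 t i.-1 < nth 0 t i)%N else e).

(** [a] and [b] tell whether the steps into and out of the letter go up. *)
Definition letter_weight (R : comNzRingType) (x y z w : R) (a b : bool) : R :=
  if a then if b then w else x else if b then z else y.

Definition word_weight (R : comNzRingType) (x y z w : R) (e : bool)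
    (t : seq nat) : R :=
  \prod_(0 <= i < size t) letter_weight x y z w (rises e t i) (rises e t i.+1).

(** Every letter of [u] exceeds [m], so the step from the last letter of [u] to [m] falls, just as
    the step to a right boundary 0 does. *)
Lemma rises_cat_left (e : bool) (u v : seq nat) (m i : nat) :
  all (ltn m) u -> (i <= size u)%N -> (0 < size u)%N ->
  rises e (u ++ m :: v) i = rises false u i.
Proof.
move=> /allP lt_m_u le_i u_gt0; rewrite /rises; case: i le_i => [//|i] le_i /=.
rewrite size_cat /= !nth_cat le_i (_ : i.+1 < _)%N ?addnS ?ltnS; last first.
  by apply: leq_trans le_i _; rewrite leq_addr.
case: (ltnP i.+1) => // ge_i; have -> : i.+1 = size u by lia.
rewrite subnn /=.
by apply/negbTE; rewrite -leqNgt ltnW //; apply/lt_m_u/mem_nth.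
Qed.

(** The step out of [m] rises, like any first step: to the larger first letter of [v], or to +oo
    when [v] is empty. *)
Lemma rises_cat_right (u v : seq nat) (m i : nat) :
  all (ltn m) v -> (i <= size v)%N ->
  rises true (u ++ m :: v) (i + (size u).+1) = rises true v i.
Proof.
move=> /allP lt_m_v le_i; rewrite /rises size_cat /= addnS /= !nth_cat.
have -> : (i + size u < size u)%N = false by lia.
have -> : ((i + size u).+1 < size u)%N = false by lia.
have -> : ((i + size u).+1 < size u + (size v).+1)%N = (i < size v)%N by lia.
have -> : (i + size u - size u = i)%N by lia.
have -> : ((i + size u).+1 - size u = i.+1)%N by lia.
case: i le_i => [|i] le_i //=; case: ltnP => // v_gt0.
exact/lt_m_v/mem_nth.
Qed.

Lemma word_weight_split (R : comNzRingType) (x y z w : R) (u v : seq nat)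
    (m : nat) :
  all (ltn m) u -> all (ltn m) v ->
  word_weight x y z w true (u ++ m :: v) =
    word_weight x y z w false u * (if nilp u then w else z)
    * word_weight x y z w true v.
Proof.
move=> lt_m_u lt_m_v; rewrite /word_weight size_cat /=.
rewrite (@big_cat_nat _ _ _ (size u)) ?leq_addr //= -mulrA; congr (_ * _).
  apply: eq_big_nat => i /andP[_ lt_i]; have u_gt0 : (0 < size u)%N by lia.
  by rewrite !rises_cat_left // ltnW.
rewrite addnS big_ltn ?ltnS ?leq_addr //; congr (_ * _).
  rewrite -[(size u).+1]add0n rises_cat_right //=.
  (* The step into [m] is an initial rise when [u] is empty, and a fall otherwise. *)
  case: u lt_m_u => [//|a u] lt_m_u; rewrite rises_cat_left //.
  by rewrite /rises /= ltnn.
rewrite -[(size u).+1]add0n big_addn.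
have -> : ((size u + size v).+1 - (size u).+1 = size v)%N by lia.
apply: eq_big_nat => i /andP[_ lt_i].
by rewrite -addSn !rises_cat_right // ltnW.
Qed.

Lemma word_weight_map (R : comNzRingType) (x y z w : R) (e : bool)
    (f : nat -> nat) (t : seq nat) :
  {in t &, {mono f : a b / (a < b)%N}} ->
  word_weight x y z w e (map f t) = word_weight x y z w e t.
Proof.
move=> mono_f; rewrite /word_weight size_map; apply: eq_bigr => i _.
suff risesE j : rises e (map f t) j = rises e t j by rewrite !risesE.
rewrite /rises size_map; case: j => [//|j] /=; case: ltnP => // lt_j.
by rewrite !(nth_map 0%N) ?mono_f ?mem_nth // ltnW.
Qed.

(** * Sums over the permutations of a set of letters *)

Definition perm_weight (R : comNzRingType) (x y z w : R) (e : bool) (n : nat)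
    : R :=
  \sum_(t <- permutations (iota 0 n)) word_weight x y z w e t.

(** A counting argument: distinct rearrangements of [s], as many as there are in all, exhaust
    them. *)
Lemma perm_eq_permutations (T : eqType) (s : seq T) (ts : seq (seq T)) :
  uniq s -> uniq ts -> {in ts, forall t, perm_eq t s} ->
  size ts = (size s)`! -> perm_eq ts (permutations s).
Proof.
move=> s_uniq ts_uniq perm_ts size_ts; apply: uniq_perm => //.
  exact: permutations_uniq.
have [|//|_ ?] // := @uniq_min_size _ ts (permutations s) ts_uniq _.
  by move=> t /perm_ts; rewrite mem_permutations.
by rewrite size_ts size_permutations.
Qed.

Lemma permutations_map (T U : eqType) (f : T -> U) (s : seq T) :
  {in s &, injective f} -> uniq s ->
  perm_eq (map (map f) (permutations s)) (permutations (map f s)).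
Proof.
move=> f_inj s_uniq; apply: perm_eq_permutations.
- by rewrite map_inj_in_uniq.
- rewrite map_inj_in_uniq ?permutations_uniq // => t1 t2.
  rewrite !mem_permutations => /perm_mem t1s /perm_mem t2s.
  by apply: (inj_in_map f_inj); apply/allP => a; rewrite ?t1s ?t2s.
- by move=> _ /mapP[t ts ->]; rewrite perm_map // -mem_permutations.
- by rewrite !size_map size_permutations.
Qed.

(** Standardization: the increasing map [nth 0 s] carries the letters 0, 1, ... to those of [s], and
    weights depend only on relative order. *)
Lemma sum_permutations_sorted (R : comNzRingType) (x y z w : R) (e : bool)
    (s : seq nat) :
  sorted ltn s ->
  \sum_(t <- permutations s) word_weight x y z w e t =
    perm_weight x y z w e (size s).
Proof.
move=> s_sorted; have mem_iota0 := mem_iota 0 (size s).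
have mono_nth : {in iota 0 (size s) &, {mono nth 0%N s : i j / (i < j)%N}}.
  have homo_nth i j : (j < size s -> i < j -> nth 0 s i < nth 0 s j)%N.
    move=> lt_j lt_ij; apply: (sorted_ltn_nth ltn_trans) => //.
    exact: ltn_trans lt_j.
  move=> i j; rewrite !mem_iota0 /= => lt_i lt_j.
  case: (ltngtP i j) => [lt_ij|lt_ji|->]; [exact: homo_nth | | exact: ltnn].
  by apply/negbTE; rewrite -leqNgt ltnW // homo_nth.
have inj_nth : {in iota 0 (size s) &, injective (nth 0%N s)}.
  move=> i j i_in j_in eq_ij; case: (ltngtP i j) => //.
    by rewrite -(mono_nth i j) // eq_ij ltnn.
  by rewrite -(mono_nth j i) // eq_ij ltnn.
have {1}-> : s = map (nth 0%N s) (iota 0 (size s)).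
  by rewrite map_nth_iota0 // take_size.
rewrite -(perm_big _ (permutations_map inj_nth (iota_uniq _ _))) big_map.
rewrite /perm_weight !big_seq; apply: eq_bigr => t.
rewrite mem_permutations => /perm_mem ts; apply: word_weight_map => i j.
by rewrite !ts; apply: mono_nth.
Qed.

(** * Splitting permutations at the smallest letter *)

(* Ordinals are shifted by 1, leaving 0 for the smallest letter. *)
Definition block (n : nat) (A : {set 'I_n}) : seq nat :=
  [seq i.+1 | i : 'I_n <- enum A].

Lemma sorted_block (n : nat) (A : {set 'I_n}) : sorted ltn (block A).
Proof.
rewrite sorted_map /enum_mem -enumT; apply: sorted_filter => [i j k|].
  exact: ltn_trans.
by have /= <- := @sorted_map _ _ val ltn (enum 'I_n);
  rewrite val_enum_ord iota_ltn_sorted.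
Qed.

Lemma block_uniq (n : nat) (A : {set 'I_n}) : uniq (block A).
Proof. by have -> := sorted_uniq ltn_trans ltnn (sorted_block A). Qed.

Lemma size_block (n : nat) (A : {set 'I_n}) : size (block A) = #|A|.
Proof. by rewrite size_map cardE. Qed.

Lemma mem_block (n : nat) (A : {set 'I_n}) (i : 'I_n) :
  (i.+1 \in block A) = (i \in A).
Proof.
by rewrite mem_map ?mem_enum // => j k /succn_inj /val_inj.
Qed.

Lemma block_gt0 (n : nat) (A : {set 'I_n}) : all (ltn 0) (block A).
Proof. by apply/allP => _ /mapP[i _ ->]. Qed.

Lemma perm_blockC (n : nat) (A : {set 'I_n}) :
  perm_eq (block A ++ block (~: A)) (iota 1 n).
Proof.
rewrite -map_cat -(addn0 1%N) iotaDl -val_enum_ord -map_comp perm_map //.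
have -> : enum (~: A) = [seq i <- enum 'I_n | predC (mem A) i].
  by rewrite enumT; apply: eq_filter => i; apply: in_setC.
have -> : enum A = [seq i <- enum 'I_n | mem A i] by rewrite enumT.
by rewrite perm_filterC.
Qed.

(** [A] collects the letters to the right of 0, and each pair lists the right part first. *)
Definition min_splits (n : nat) : seq (seq nat) :=
  [seq p.2 ++ 0%N :: p.1 | A <- enum {set 'I_n},
     p <- [seq (v, u) | v <- permutations (block A),
                        u <- permutations (block (~: A))]].

(** The splitting is unique: the only 0 marks the cut, and the letters after it determine [A]. *)
Lemma perm_min_splits (n : nat) :
  perm_eq (permutations (iota 0 n.+1)) (min_splits n).
Proof.
have blockP (A : {set 'I_n}) t : t \in permutations (block A) ->
    forall i : 'I_n, (i.+1 \in t) = (i \in A).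
  by rewrite mem_permutations => /perm_mem tA i; rewrite tA mem_block.
have gt0P (A : {set 'I_n}) t : t \in permutations (block A) -> 0%N \notin t.
  rewrite mem_permutations => /perm_mem tA; rewrite tA.
  by apply/negP => /(allP (block_gt0 A)).
have cat_inj (u1 v1 u2 v2 : seq nat) : 0%N \notin u1 -> 0%N \notin u2 ->
    u1 ++ 0%N :: v1 = u2 ++ 0%N :: v2 -> (u1 = u2) /\ (v1 = v2).
  move=> u1P u2P eq12; have size12 : size u1 = size u2.
    have := congr1 (index 0%N) eq12.
    by rewrite !index_cat (negbTE u1P) (negbTE u2P) /= !addn0.
  by have /eqP := eq12; rewrite eqseq_cat // => /andP[/eqP-> /eqP[->]].
apply: uniq_perm; first exact: permutations_uniq.
  apply: allpairs_uniq_dep => [|A _|]; first exact: enum_uniq.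
    by rewrite allpairs_uniq ?permutations_uniq // => -[? ?] [? ?].
  move=> a1 a2 /allpairsPdep[A1 [p1 [_ p1P ->]]].
  case/allpairsP: p1P => -[v1 u1] /= [v1P u1P ->].
  case/allpairsPdep=> [A2 [p2 [_ p2P ->]]] /=.
  case/allpairsP: p2P => -[v2 u2] /= [v2P u2P ->] /=.
  case/cat_inj; [exact: gt0P u1P | exact: gt0P u2P | move=> eq_u eq_v].
  subst u2 v2; suff -> : A1 = A2 by [].
  by apply/setP => i; rewrite -(blockP _ _ v1P) (blockP _ _ v2P).
move=> t; rewrite mem_permutations; apply/idP/allpairsPdep.
  move=> t_perm; have t_uniq : uniq t by rewrite (perm_uniq t_perm) iota_uniq.
  have t0 : 0%N \in t by rewrite (perm_mem t_perm) mem_iota.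
  case/splitPr: t0 t_perm t_uniq => u v; set t' := u ++ _ => t_perm t_uniq.
  exists [set i : 'I_n | i.+1 \in v], (v, u); split; rewrite ?mem_enum //.
  have mem_t i : (i \in t') = (i < n.+1)%N.
    by rewrite (perm_mem t_perm) mem_iota.
  have := t_uniq; rewrite cat_uniq /= negb_or.
  case/and3P=> u_uniq /andP[u0 /hasPn uv] /andP[v0 v_uniq].
  apply/allpairsP; exists (v, u); split; rewrite ?mem_permutations //=.
    apply: uniq_perm => // [|i]; first exact: block_uniq.
    apply/idP/mapP => [iv|[j]]; last by rewrite mem_enum inE => ? ->.
    case: i iv => [|i] iv; first by rewrite iv in v0.
    have lt_i : (i < n)%N by rewrite -ltnS -mem_t mem_cat inE iv !orbT.
    by exists (Ordinal lt_i); rewrite ?mem_enum ?inE.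
  apply: uniq_perm => // [|i]; first exact: block_uniq.
  apply/idP/mapP => [iu|[j]]; last first.
    rewrite mem_enum !inE => jv ->; have := mem_t j.+1.
    by rewrite mem_cat inE (negbTE jv) /= orbF ltnS ltn_ord => ->.
  case: i iu => [|i] iu; first by rewrite iu in u0.
  have lt_i : (i < n)%N by rewrite -ltnS -mem_t mem_cat iu.
  exists (Ordinal lt_i); rewrite ?mem_enum ?inE //=.
  by apply/negP => /uv; rewrite /= iu.
case=> A [p [_ pA ->]]; case/allpairsP: pA => -[v u] /= [vA uA ->] /=.
rewrite !mem_permutations in vA uA.
by rewrite perm_catC /= perm_cons (perm_trans (perm_cat vA uA)) ?perm_blockC.
Qed.

(** Here [k] is the length of the part after the smallest letter, and the last factor is the weight
    of that letter. *)
Lemma perm_weight_rec (R : comNzRingType) (x y z w : R) (n : nat) :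
  perm_weight x y z w true n.+1 =
    \sum_(k < n.+1) 'C(n, k)%:R * (perm_weight x y z w true k
      * perm_weight x y z w false (n - k) * (if n - k == 0 then w else z)%N).
Proof.
rewrite {1}/perm_weight (perm_big _ (perm_min_splits n)) big_allpairs_dep.
transitivity (\sum_(A : {set 'I_n}) perm_weight x y z w true #|A|
   * perm_weight x y z w false (n - #|A|) * (if n - #|A| == 0 then w else z)%N).
  rewrite big_enum; apply: eq_bigr => A _.
  have sizeC : (n - #|A| = size (block (~: A)))%N.
    by rewrite size_block [in RHS]cardsCs card_ord setCK.
  rewrite big_allpairs_dep sizeC -(size_block A).
  rewrite -!sum_permutations_sorted ?sorted_block // !mulr_suml.
  rewrite !big_seq; apply: eq_bigr => v vA; rewrite mulr_sumr mulr_suml.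
  rewrite !big_seq; apply: eq_bigr => u uA /=.
  rewrite !mem_permutations in vA uA.
  have gt0 t B : perm_eq t (@block n B) -> all (ltn 0) t.
    by move=> tB; rewrite (perm_all _ tB) block_gt0.
  rewrite word_weight_split ?(gt0 _ _ vA) ?(gt0 _ _ uA) //.
  by rewrite /nilp (perm_size uA) mulrC mulrA.
(* The summand depends only on the size of [A], which is at most [n], so [inord] keeps it; each size
   [k] then accounts for ['C(n, k)] sets. *)
rewrite (partition_big (fun A : {set 'I_n} => inord #|A| : 'I_n.+1) predT) //=.
apply: eq_bigr => k _.
rewrite (eq_bigr (fun=> perm_weight x y z w true k
  * perm_weight x y z w false (n - k) * (if n - k == 0 then w else z)%N)).
  rewrite sumr_const mulr_natl; congr (_ *+ _).
  have := card_draws 'I_n k; rewrite card_ord => <-.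
  apply: eq_card => A; rewrite inE unfold_in /= inordK // ltnS.
  by rewrite -[X in (_ <= X)%N](card_ord n) max_card.
move=> A /eqP <-; rewrite inordK // ltnS.
by rewrite -[X in (_ <= X)%N](card_ord n) max_card.
Qed.

(** * Weights as monomials in the statistics *)

Lemma prod_letter_weight (R : comNzRingType) (x y z w : R) (I : Type)
    (r : seq I) (a b : pred I) :
  \prod_(i <- r) letter_weight x y z w (a i) (b i) =
    x ^+ count (fun i => a i && ~~ b i) r
    * y ^+ count (fun i => ~~ a i && ~~ b i) r
    * z ^+ count (fun i => ~~ a i && b i) r
    * w ^+ count (fun i => a i && b i) r.
Proof.
elim: r => [|i r IHr]; first by rewrite big_nil !expr0 !mulr1.
rewrite big_cons IHr /=.
by case: (a i) (b i) => [] [] /=; rewrite ?add0n ?add1n ?exprS; ring.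
Qed.

(** Switches of a boolean sequence alternate in direction, so the two ends fix the difference of
    their numbers. Applied to [rises], it compares peaks with valleys. *)
Lemma count_falls_rises (a : pred nat) (n : nat) :
  (count (fun i => a i && ~~ a i.+1) (iota 0 n) + a n =
   count (fun i => ~~ a i && a i.+1) (iota 0 n) + a 0)%N.
Proof.
elim: n => [//|n IHn]; rewrite -addn1 iotaD !count_cat /= !add0n addn1.
by case: (a n) (a n.+1) IHn => [] [] /=; lia.
Qed.

Lemma count_quadrants (T : Type) (a b : pred T) (s : seq T) :
  (count (fun i => a i && ~~ b i) s + count (fun i => ~~ a i && ~~ b i) s
   + count (fun i => ~~ a i && b i) s + count (fun i => a i && b i) s
   = size s)%N.
Proof.
by elim: s => [//|i s] /=; case: (a i) (b i) => [] [] /=; lia.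
Qed.

(** The first step rises and the last one is given by [e], so there are [p + e - 1] valleys; the
    extra [z] makes up for the 1. The double ascents are the remaining letters. *)
Lemma word_weight_counts (R : comNzRingType) (x y z w : R) (e : bool)
    (t : seq nat) (n p d : nat) :
  size t = n -> e || (0 < n)%N ->
  count (fun i => rises e t i && ~~ rises e t i.+1) (iota 0 n) = p ->
  count (fun i => ~~ rises e t i && ~~ rises e t i.+1) (iota 0 n) = d ->
  z * word_weight x y z w e t =
    x ^+ p * y ^+ d * z ^+ (p + e) * w ^+ (n + ~~ e - 2 * p - d).
Proof.
move=> size_t e_n count_p count_d.
have := count_falls_rises (rises e t) n.
have := count_quadrants (rises e t) (fun i => rises e t i.+1) (iota 0 n).
rewrite /word_weight /index_iota subn0 prod_letter_weight size_t.
(* In an empty word this step is also the first one, which always rises; hence the condition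
   [e || (0 < n)]. *)
have -> : rises e t n = e.
  by rewrite /rises size_t ltnn; case: (n) (e) e_n => [|k] [].
rewrite count_p count_d size_iota.
set v := count _ _; set a := count _ _ => sum_n balance.
have -> : (p + e = v.+1)%N by case: (e) balance => /=; lia.
have -> : (n + ~~ e - 2 * p - d = a)%N.
  by case: (e) balance => /=; lia.
by rewrite exprS; ring.
Qed.

(** Turns the double sums over numbers of permutations into sums over the permutations
    themselves. *)
Lemma sum_over_stats (R : comNzRingType) (T : finType) (N : nat)
    (p d : T -> nat) (F : nat -> nat -> R) :
  (forall s, p s < N)%N -> (forall s, d s < N)%N ->
  \sum_(i < N) \sum_(j < N)
    #|[set s | (p s == i) && (d s == j)]|%:R * F i j =
  \sum_s F (p s) (d s).
Proof.
move=> p_lt d_lt.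
rewrite [RHS](partition_big (fun s => Ordinal (p_lt s)) predT) //=.
apply: eq_bigr => i _.
rewrite [RHS](partition_big (fun s => Ordinal (d_lt s)) predT) //=.
apply: eq_bigr => j _.
rewrite mulr_natl -sumr_const; apply: eq_big => s; first by rewrite inE.
by rewrite inE => /andP[/eqP-> /eqP->].
Qed.

(** * Permutations as words, and their statistics *)

Definition word (n : nat) (s : 'S_n) : seq nat :=
  [seq val (s i) | i <- enum 'I_n].

Lemma size_word (n : nat) (s : 'S_n) : size (word s) = n.
Proof. by rewrite size_map size_enum_ord. Qed.

Lemma nth_word (n : nat) (s : 'S_n) (i : 'I_n) : nth 0%N (word s) i = s i.
Proof. by rewrite (nth_map i) ?size_enum_ord // nth_ord_enum. Qed.

Lemma sum_words (R : comNzRingType) (n : nat) (F : seq nat -> R) :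
  \sum_(s : 'S_n) F (word s) = \sum_(t <- permutations (iota 0 n)) F t.
Proof.
suff words : perm_eq [seq word s | s : 'S_n] (permutations (iota 0 n)).
  by rewrite -(perm_big _ words) big_image.
apply: perm_eq_permutations; first exact: iota_uniq.
- rewrite map_inj_uniq ?enum_uniq // => s1 s2 eq_word; apply/permP => i.
  by apply: val_inj; rewrite /= -!nth_word eq_word.
- move=> _ /mapP[s _ ->]; rewrite /word -val_enum_ord map_comp perm_map //.
  apply: uniq_perm => [||i]; rewrite ?enum_uniq //.
    by rewrite map_inj_uniq ?enum_uniq //; apply: perm_inj.
  rewrite mem_enum; apply/mapP; exists ((s^-1)%g i).
    by rewrite mem_enum.
  by rewrite permKV.
- by rewrite size_map -cardE card_Sn size_iota.
Qed.

(** The shift by one puts the letters of [word], which start at 0, above the boundary value 0 of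
    [letter]. *)
Lemma letter_word (n : nat) (s : 'S_n) (i : nat) :
  letter s i.+1 = if (i < n)%N then (nth 0 (word s) i).+1 else 0%N.
Proof.
rewrite /letter; case: insubP => [j /= -> <-|/negbTE-> //].
by rewrite nth_word.
Qed.

Lemma rises_letter (e : bool) (n : nat) (s : 'S_n) (i : nat) :
  (i < n)%N -> rises e (word s) i = (letter s i < letter s i.+1)%N.
Proof.
move=> lt_i; rewrite letter_word lt_i /rises size_word lt_i.
by case: i lt_i => [//|i] lt_i; rewrite letter_word (ltnW lt_i).
Qed.

Lemma falls_letter (n : nat) (s : 'S_n) (i : nat) :
  (i <= n)%N ->
  ~~ rises false (word s) i = (letter s i.+1 < letter s i)%N.
Proof.
case: i => [//|i] lt_i.
rewrite !letter_word (lt_i : (i < n)%N) /rises size_word /=.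
case: ltnP => // lt_i1; rewrite ltnS -leqNgt leq_eqVlt; case: eqP => //.
(* Equal neighbouring letters would contradict the injectivity of [s]. *)
rewrite (nth_word s (Ordinal lt_i1)) (nth_word s (Ordinal lt_i)).
by move=> /val_inj/perm_inj/(congr1 val) /= eq_i; lia.
Qed.

(** Raising the right boundary to +oo removes only the fall after the last letter. *)
Lemma falls_true (n : nat) (s : 'S_n) (i : nat) :
  ~~ rises true (word s) i = (i < n)%N && ~~ rises false (word s) i.
Proof. by rewrite /rises size_word; case: ltnP => //; rewrite orbT. Qed.

Lemma count_iota1 (a : pred nat) (n : nat) :
  count a (iota 1 n) = count (fun i => a i.+1) (iota 0 n).
Proof. by rewrite -(addn0 1%N) iotaDl count_map. Qed.

(** Between 0 and +oo, the first letter is a peak as soon as a smaller letter follows it, and the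
    last letter never is. *)
Lemma exterior_peak_count (n : nat) (s : 'S_n) :
  count (fun i => rises true (word s) i && ~~ rises true (word s) i.+1)
    (iota 0 n) = index_count n (exterior_peak s).
Proof.
rewrite /index_count count_iota1; apply: eq_in_count => i.
rewrite mem_iota /= => lt_i; rewrite falls_true falls_letter // rises_letter //.
rewrite /exterior_peak; case: i lt_i => [|i] lt_i; last by rewrite andbCA.
by rewrite letter_word lt_i /= orbF.
Qed.

(** A proper double descent is indexed by the last of its three letters, but the weight [y] sits on
    the middle one. *)
Lemma proper_double_descent_count (n : nat) (s : 'S_n) :
  count (fun i => ~~ rises true (word s) i && ~~ rises true (word s) i.+1)
    (iota 0 n) = index_count n (proper_double_descent s).
Proof.
have pddSn : proper_double_descent s n.+1 = false.
  by rewrite /proper_double_descent ltnn andbF.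
(* To shift the indices by one, [n.+1] is appended and 1 is then dropped; neither is a proper double
   descent. *)
have -> : index_count n (proper_double_descent s) =
    count (proper_double_descent s) (iota 1 n.+1).
  by rewrite -(addn1 n) iotaD count_cat /= add1n pddSn !addn0.
rewrite count_iota1 /= add0n count_iota1; apply: eq_in_count => i.
rewrite mem_iota /= => lt_i; rewrite !falls_true lt_i /proper_double_descent.
rewrite !falls_letter //; last exact: ltnW.
by case: i lt_i => [|i] lt_i //=; rewrite andbCA.
Qed.

Lemma peak_count (n : nat) (s : 'S_n) :
  count (fun i => rises false (word s) i && ~~ rises false (word s) i.+1)
    (iota 0 n) = index_count n (peak s).
Proof.
rewrite /index_count count_iota1; apply: eq_in_count => i.
rewrite mem_iota => lt_i; rewrite falls_letter // rises_letter //.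
by rewrite /peak lt_i.
Qed.

Lemma double_descent_count (n : nat) (s : 'S_n) :
  count (fun i => ~~ rises false (word s) i && ~~ rises false (word s) i.+1)
    (iota 0 n) = index_count n (double_descent s).
Proof.
rewrite /index_count count_iota1; apply: eq_in_count => i.
rewrite mem_iota => lt_i; rewrite !falls_letter //; last exact: ltnW.
by rewrite /double_descent lt_i.
Qed.

Lemma index_count_lt (n : nat) (a : pred nat) : (index_count n a < n.+1)%N.
Proof. by rewrite ltnS -[leqRHS](size_iota 1) count_size. Qed.

(** * The generating polynomials and their recurrence *)

Lemma P_polyE (R : comNzRingType) (n : nat) (x y z w : R) :
  P_poly n x y z w = z * perm_weight x y z w true n.
Proof.
rewrite /perm_weight -sum_words mulr_sumr /P_poly.
under eq_bigr => i _ do under eq_bigr => j _ do rewrite -!mulrA.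
rewrite (sum_over_stats (fun i j =>
  x ^+ i * (y ^+ j * (z ^+ i.+1 * w ^+ (n - 2 * i - j)))))
  => [|s|s]; try exact: index_count_lt.
apply: eq_bigr => s _.
rewrite (word_weight_counts _ _ _ _ (size_word s) _ (exterior_peak_count s)
  (proper_double_descent_count s)) //.
by rewrite !mulrA addn1 addn0.
Qed.

Lemma Q_polyE (R : comNzRingType) (n : nat) (x y z w : R) :
  (0 < n)%N -> Q_poly n x y z w = z * perm_weight x y z w false n.
Proof.
move=> n_gt0; rewrite /perm_weight -sum_words mulr_sumr /Q_poly.
under eq_bigr => i _ do under eq_bigr => j _ do rewrite -!mulrA.
rewrite (sum_over_stats (fun i j =>
  x ^+ i * (y ^+ j * (z ^+ i * w ^+ (n.+1 - 2 * i - j)))))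
  => [|s|s]; try exact: index_count_lt.
apply: eq_bigr => s _.
rewrite (word_weight_counts _ _ _ _ (size_word s) _ (peak_count s)
  (double_descent_count s)) //.
by rewrite !mulrA addn1 addn0.
Qed.

Theorem theorem2p3 (R : comNzRingType) (n : nat) (x y z w : R) :
  P_poly n.+1 x y z w =
    w * P_poly n x y z w
    + \sum_(k < n) ('C(n, k))%:R * P_poly k x y z w * Q_poly (n - k) x y z w.
Proof.
(* The term [k = n], where the smallest letter comes first and has weight [w], is split off. *)
rewrite !P_polyE perm_weight_rec big_ord_recr /= subnn binn.
have -> : perm_weight x y z w false 0 = 1.
  by rewrite /perm_weight big_seq1 /word_weight big_geq.
rewrite mulrDr addrC; congr (_ + _); first by rewrite eqxx; ring.
rewrite mulr_sumr; apply: eq_bigr => k _.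
(* For [k < n] the smallest letter is a valley, and its weight [z] is the factor that completes
   [Q_poly]. *)
have nk_gt0 : (0 < n - k)%N by rewrite subn_gt0.
by rewrite P_polyE Q_polyE // eqn0Ngt nk_gt0 /=; ring.
Qed.
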